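(* Let $\nu\in\mathbb{N}$, $\nu\ge 1$, let $\alpha=1/\nu$, and let $z=\omega_0 e^{\mathrm{j}\varphi}\in\mathbb{C}$ with $\omega_0>0$, $\varphi=\arg(z)$ and $\operatorname{Re}(z)>0$, and let $\bar z=\omega_0e^{-\mathrm{j}\varphi}$. For $k\in\{-1,1\}$ put $\mathcal{Q}_{z,\nu}^k(s)=Q_{z,\nu}^k(s)\,Q_{\bar z,\nu}^k(s)$, where $$Q_{z,\nu}^k(s)=\left(\sum_{n=1}^{\nu}\left(\frac{s}{z}\right)^{\frac{n-1}{\nu}}\right)^k .$$ Then all pseudo zeros (if $k=1$), respectively all pseudo poles (if $k=-1$), of $\mathcal{Q}_{z,\nu}^k$ are located in the stable region $\mathbb{C}_\alpha=\{w\in\mathbb{C} : |\arg(w)|>\alpha\frac{\pi}{2}\}$.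
   Context: $\mathrm{j}$ is the imaginary unit and $\arg$ is the principal argument, with values in $(-\pi,\pi]$. Fractional powers are principal: $\left(\frac{s}{z}\right)^{\frac{m}{\nu}}$ means $\left(s^{1/\nu}/z^{1/\nu}\right)^m$, where $z^{1/\nu}=\omega_0^{1/\nu}e^{\mathrm{j}\varphi/\nu}$ is the principal $\nu$-th root (and $\bar z^{1/\nu}=\omega_0^{1/\nu}e^{-\mathrm{j}\varphi/\nu}$). A pseudo polynomial of commensurate order $\alpha=1/\nu$ is an expression $B(s^{\alpha})$ with $B$ an ordinary polynomial. The pseudo zeros of $B(s^\alpha)$ are the roots $w\in\mathbb{C}$ of the ordinary polynomial $B(w)$ in the variable $w=s^{\alpha}$; the pseudo poles of $1/B(s^\alpha)$ are the same roots. Thus the pseudo zeros of $\mathcal{Q}_{z,\nu}^1$ are the roots in $w$ of $\left(\sum_{m=0}^{\nu-1}(w/z^{1/\nu})^m\right)\left(\sum_{m=0}^{\nu-1}(w/\bar z^{1/\nu})^m\right)$. *)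

(* Defs.v *)
From HB Require Import structures.
From mathcomp Require Import all_boot all_order all_algebra.
From mathcomp Require Import complex.
From mathcomp Require Import boolp classical_sets reals trigo exp.

Set Implicit Arguments.
Unset Strict Implicit.
Unset Printing Implicit Defensive.

Import Order.TTheory GRing.Theory Num.Theory.
Import ComplexField.Normc.

Local Open Scope complex_scope.
Local Open Scope ring_scope.

(* r e^(j t) *)
Definition cpolar (R : realType) (r t : R) : R[i] :=
  (r * cos t) +i* (r * sin t).

(* The principal argument, in (-pi, pi]; see carg_spec below.
   Pitfall: acos (0 / 0) = pi / 2, so 0 needs a case of its own. The argument
   of 0 is set to 0, hence 0 never lies in a stable region. *)
Definition carg (R : realType) (z : R[i]) : R :=
  if z == 0 then 0
  else if 0 <= complex.Im z then acos (complex.Re z / normc z)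
  else - acos (complex.Re z / normc z).

(* The principal power z ^ a for a real exponent a; for a = 1 / nu this is the
   principal nu-th root, and 0 ^ a = 0 when a <> 0. *)
Definition cpow (R : realType) (z : R[i]) (a : R) : R[i] :=
  cpolar (normc z `^ a) (a * carg z).

(* Pseudo polynomials are functions of s of the form B(s ^ alpha). When
   alpha <> 0 the polynomial B is determined by the function, so the existential
   quantifiers below refer to a unique B (pseudo_zeroE and pseudo_poleE). *)
Definition pseudo_zero (R : realType) (alpha : R) (f : R[i] -> R[i])
    (w : R[i]) : Prop :=
  exists2 B : {poly R[i]}, forall s, f s = B.[cpow s alpha] & root B w.

Definition pseudo_pole (R : realType) (alpha : R) (f : R[i] -> R[i])
    (w : R[i]) : Prop :=
  exists2 B : {poly R[i]}, forall s, f s = (B.[cpow s alpha])^-1 & root B w.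

(* (s / z) ^ (m / nu) is read as (s ^ (1 / nu) / z ^ (1 / nu)) ^ m, which is in
   general not the principal power of the quotient s / z. *)
Definition frac_pow (R : realType) (nu : nat) (z s : R[i]) (m : nat) : R[i] :=
  (cpow s (nu%:R^-1) / cpow z (nu%:R^-1)) ^+ m.

Definition Q_factor (R : realType) (nu : nat) (k : int) (z s : R[i]) : R[i] :=
  (\sum_(1 <= n < nu.+1) frac_pow nu z s n.-1) ^ k.

(* The conjugate of r e^(j t) is r e^(- j t), see cpolar_conj. *)
Definition Q_prod (R : realType) (nu : nat) (k : int) (z s : R[i]) : R[i] :=
  Q_factor nu k z s * Q_factor nu k z^* s.

Definition stable_region (R : realType) (alpha : R) : set R[i] :=
  [set w | alpha * (pi / 2) < `|carg w|]%classic.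

Section Sanity.
Variable R : realType.
Implicit Types (z w s : R[i]) (B : {poly R[i]}).

Lemma cpolar_conj (r t : R) : (cpolar r t)^* = cpolar r (- t).
Proof. by rewrite /cpolar cosN sinN mulrN. Qed.

Lemma normc_gt0 z : z != 0 -> 0 < normc z.
Proof.
move=> z0; rewrite lt_def; apply/andP; split.
  by apply: contra z0 => /eqP/eq0_normc ->.
by case: z {z0} => a b /=; rewrite sqrtr_ge0.
Qed.

Lemma carg_spec z : z != 0 ->
  - pi < carg z <= pi /\ z = cpolar (normc z) (carg z).
Proof.
move=> z0; have n0 := normc_gt0 z0; rewrite /carg (negbTE z0).
case: z z0 n0 => a b /= z0 n0; set n := Num.sqrt _ in n0 *.
have nn : n != 0 by rewrite gt_eqF.
have n2 : n ^+ 2 = a ^+ 2 + b ^+ 2 by rewrite sqr_sqrtr ?addr_ge0 ?sqr_ge0.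
have c2 : 1 - (a / n) ^+ 2 = (b / n) ^+ 2.
  rewrite !expr_div_n -[1](@divff _ (n ^+ 2)) ?expf_neq0 // -mulrBl n2.
  by rewrite addrAC subrr add0r.
have ac : -1 <= a / n <= 1.
  rewrite -ler_norml.
  rewrite -(@ler_pXn2r _ 2) ?nnegrE // expr1n real_normK ?num_real //.
  by rewrite -subr_ge0 c2 sqr_ge0.
have cK : cos (acos (a / n)) = a / n by apply: acosK; rewrite in_itv.
have sK : sin (acos (a / n)) = `|b| / n.
  by rewrite sin_acos // c2 sqrtr_sqr normrM normfV (gtr0_norm n0).
have an x : n * (x / n) = x by rewrite mulrC divfK.
case: ifPn => [b0|].
  split; last by rewrite /cpolar cK sK an an ger0_norm.
  by rewrite acos_lepi // (lt_le_trans _ (acos_ge0 ac)) // oppr_lt0 pi_gt0.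
rewrite -ltNge => b0; split; last first.
  by rewrite /cpolar cosN sinN cK sK ltr0_norm // mulNr opprK an an.
rewrite ltrN2; apply/andP; split; last first.
  by rewrite (le_trans _ (pi_ge0 R)) // oppr_le0 acos_ge0.
apply: acos_ltpi; case/andP: ac => ac1 -> ; rewrite andbT lt_def ac1 andbT.
apply/eqP => E; move: c2; rewrite E sqrrN expr1n subrr => /esym/eqP.
by rewrite sqrf_eq0 mulf_eq0 invr_eq0 (lt_eqF b0) (negbTE nn).
Qed.

Lemma pseudo_poly_inj (alpha : R) B1 B2 : alpha != 0 ->
  (forall s, B1.[cpow s alpha] = B2.[cpow s alpha]) -> B1 = B2.
Proof.
move=> a0 E; apply/eqP; rewrite -subr_eq0; apply/negPn/negP => D0.
pose rs : seq R[i] := [seq n.+1%:R | n <- iota 0 (size (B1 - B2))].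
have /(max_poly_roots D0) : all (root (B1 - B2)) rs.
  apply/allP => _ /mapP[n _ ->]; rewrite rootE hornerD hornerN subr_eq0.
  have := E ((n.+1%:R `^ alpha^-1)%:C : R[i]); rewrite {1 2}/cpow /=.
  set p := _ `^ alpha^-1; have p0 : 0 < p by rewrite powR_gt0 ?ltr0Sn.
  have np : Num.sqrt (p ^+ 2 + 0 ^+ 2) = p.
    by rewrite expr0n addr0 sqrtr_sqr gtr0_norm.
  have -> : carg p%:C = 0.
    rewrite /carg; case: ifP => // _ /=.
    by rewrite lexx np divff ?gt_eqF // acos1.
  rewrite np mulr0 /cpolar cos0 sin0 mulr1 mulr0 /p -powRrM mulVf // powRr1 //.
  have -> : (n.+1%:R +i* 0 : R[i]) = n.+1%:R by rewrite -[LHS]/((n.+1%:R)%:C) rmorph_nat.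
  by move=> ->.
have U : uniq rs.
  rewrite map_inj_uniq ?iota_uniq // => m n /eqP.
  by rewrite eqr_nat => /eqP[].
by move=> /(_ U); rewrite size_map size_iota ltnn.
Qed.

Lemma pseudo_zeroE (alpha : R) B w : alpha != 0 ->
  pseudo_zero alpha (fun s => B.[cpow s alpha]) w <-> root B w.
Proof.
move=> a0; split=> [[B' E]|]; last by exists B.
by rewrite (pseudo_poly_inj a0 E).
Qed.

Lemma pseudo_poleE (alpha : R) B w : alpha != 0 ->
  pseudo_pole alpha (fun s => (B.[cpow s alpha])^-1) w <-> root B w.
Proof.
move=> a0; split=> [[B' E]|]; last by exists B.
by rewrite (@pseudo_poly_inj alpha B B' a0) // => s; apply/invr_inj/E.
Qed.

Lemma Q_prod1E (nu : nat) z s : Q_prod nu 1 z s =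
  (\prod_(x <- [:: z; z^*])
     \sum_(m < nu) (cpow x nu%:R^-1)^-1 ^+ m *: 'X^m).[cpow s nu%:R^-1].
Proof.
rewrite big_cons big_seq1 hornerM /Q_prod /Q_factor !expr1z.
congr (_ * _); rewrite big_add1 big_mkord horner_sum; apply: eq_bigr => i _;
  by rewrite hornerZ hornerXn /frac_pow expr_div_n exprVn mulrC.
Qed.

Lemma Q_prodN1E (nu : nat) z s : Q_prod nu (- 1) z s = (Q_prod nu 1 z s)^-1.
Proof. by rewrite /Q_prod /Q_factor !exprN1 !expr1z invfM. Qed.

End Sanity.

(* Main.v *)
Require Import Defs.
From mathcomp Require Import all_boot all_order all_algebra.
From mathcomp Require Import complex.
From mathcomp Require Import boolp classical_sets reals trigo exp.
From mathcomp Require Import ring.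
Import ComplexField.Normc.
Import Order.TTheory GRing.Theory Num.Theory.
Local Open Scope complex_scope.
Local Open Scope ring_scope.

(* Let c be the principal nu-th root of z or of its conjugate. A pseudo zero w
   on the factor of c satisfies (w / c) ^ nu = 1 and w <> c, so w is another
   nu-th root of c ^ nu. Since Re (c ^ nu) > 0, the sector
   |arg w| <= pi / (2 nu) contains only one nu-th root of c ^ nu, namely c. *)

(** The geometric sum times [u - 1] telescopes to [u ^+ n - 1]. *)
Lemma sum_expr_eq0_unity (F : fieldType) (n : nat) (u : F) :
  \sum_(m < n) u ^+ m = 0 -> u ^+ n = 1.
Proof. by move=> u0; apply/eqP; rewrite -subr_eq0 subrX1 u0 mulr0. Qed.

Lemma cpolarX (R : realType) (r t : R) (n : nat) :
  cpolar r t ^+ n = cpolar (r ^+ n) (n%:R * t).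
Proof.
elim: n => [|n IHn]; first by rewrite !expr0 /cpolar mul0r cos0 sin0 mulr1 mulr0.
rewrite exprS IHn -natr1 mulrDl mul1r /cpolar cosD sinD exprS.
by apply/eqP; rewrite eq_complex /=; apply/andP; split; apply/eqP; ring.
Qed.

Lemma normc_cpolar (R : realType) (r t : R) : 0 <= r -> normc (cpolar r t) = r.
Proof.
move=> r0; rewrite /cpolar /=.
by rewrite !exprMn -mulrDr cos2Dsin2 mulr1 sqrtr_sqr ger0_norm.
Qed.

(** Norms recover the radii; cancelling them in the imaginary parts leaves equal sines, and sine is
    injective on the closed interval from -pi/2 to pi/2. *)
Lemma cpolar_inj (R : realType) (r1 t1 r2 t2 : R) : 0 < r1 -> 0 < r2 ->
  `|t1| <= pi / 2 -> `|t2| <= pi / 2 ->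
  cpolar r1 t1 = cpolar r2 t2 -> r1 = r2 /\ t1 = t2.
Proof.
move=> r1_gt0 r2_gt0 ht1 ht2 e.
have er : r1 = r2.
  by rewrite -(normc_cpolar _ _ t1 (ltW r1_gt0)) e normc_cpolar // ltW.
split=> //; move: e; rewrite er => -[_ /(mulfI (lt0r_neq0 r2_gt0))].
by apply: sin_inj; rewrite in_itv /= -ler_norml.
Qed.

(** The cosine of the argument has the sign of the real part, and cosine decreases on [0, pi] with
    its zero at pi/2. Evenness of cosine allows passing to [|carg x|]. *)
Lemma carg_le_pihalf (R : realType) (x : R[i]) :
  0 < complex.Re x -> `|carg x| <= pi / 2.
Proof.
move=> x_gt0; have x0 : x != 0 by apply: contraTneq x_gt0 => ->; rewrite ltxx.
have [/andP[lt_pi le_pi] ex] := carg_spec x0.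
have n0 := normc_gt0 x0.
have cos_gt0 : 0 < cos `|carg x|.
  by rewrite cos_norm; move: x_gt0; rewrite {1}ex /= pmulr_rgt0.
have a_le : `|carg x| <= pi by rewrite ler_norml le_pi ltW.
rewrite leNgt; apply/negP => a_gt.
have : cos `|carg x| < cos (pi / 2).
  rewrite ltr_cos // in_itv /= ?normr_ge0 ?a_le //.
  by rewrite divr_ge0 ?pi_ge0 //= ler_pdivrMr // ler_peMr ?pi_ge0 ?ler1n.
by rewrite cos_pihalf => /(lt_trans cos_gt0); rewrite ltxx.
Qed.

Lemma cpow_rootK (R : realType) (n : nat) (x : R[i]) :
  (0 < n)%N -> x != 0 -> cpow x n%:R^-1 ^+ n = x.
Proof.
move=> n_gt0 x0; have n0 : n%:R != 0 :> R by rewrite pnatr_eq0 -lt0n.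
have [_ ex] := carg_spec x0; rewrite /cpow cpolarX mulrA mulfV // mul1r.
by rewrite -powR_mulrn ?powR_ge0 // -powRrM mulVf // powRr1 ?ltW ?normc_gt0.
Qed.

(* In the sector |arg w| <= pi / (2 n), w ^ n has argument n arg w, so w is
   determined by w ^ n. *)
Lemma cpow_root_unique (R : realType) (n : nat) (x w : R[i]) :
  (0 < n)%N -> 0 < complex.Re x -> w ^+ n = x ->
  `|carg w| <= n%:R^-1 * (pi / 2) -> w = cpow x n%:R^-1.
Proof.
move=> n_gt0 x_gt0 ewx hw.
have n0 : 0 < n%:R :> R by rewrite ltr0n.
have x0 : x != 0 by apply: contraTneq x_gt0 => ->; rewrite ltxx.
(* Since [carg 0] is 0, the sector bound does not exclude 0; the equation [w ^+ n = x] with x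
   nonzero does. *)
have w0 : w != 0.
  by apply: contraNneq x0 => e; rewrite -ewx e expr0n eqn0Ngt n_gt0.
have [[_ ex] [_ ew]] := (carg_spec x0, carg_spec w0).
have [|||||er et] := @cpolar_inj R (normc w ^+ n) (n%:R * carg w)
    (normc x) (carg x).
- by rewrite exprn_gt0 ?normc_gt0.
- exact: normc_gt0.
- by rewrite normrM gtr0_norm // -ler_pdivlMl.
- exact: carg_le_pihalf.
- by rewrite -cpolarX -ew -ex.
rewrite {1}ew /cpow -er -et mulKf ?gt_eqF // -powR_mulrn ?ltW ?normc_gt0 //.
by rewrite -powRrM mulfV ?gt_eqF // powRr1 // ltW ?normc_gt0.
Qed.

Lemma root_geometric_stable (R : realType) (n : nat) (x w : R[i]) :
  (0 < n)%N -> 0 < complex.Re x ->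
  root (\sum_(m < n) (cpow x n%:R^-1)^-1 ^+ m *: 'X^m) w ->
  stable_region n%:R^-1 w.
Proof.
move=> n_gt0 x_gt0; set c := cpow x _.
have x0 : x != 0 by apply: contraTneq x_gt0 => ->; rewrite ltxx.
have cn : c ^+ n = x by exact: cpow_rootK.
have c0 : c != 0.
  by apply: contraNneq x0 => e; rewrite -cn e expr0n eqn0Ngt n_gt0.
rewrite rootE horner_sum => /eqP; under eq_bigr => i _ do
  rewrite hornerZ hornerXn -exprMn [c^-1 * w]mulrC.
move=> sum0; rewrite /stable_region /= ltNge; apply/negP => hw.
have ewx : w ^+ n = x.
  by move/sum_expr_eq0_unity: (sum0); rewrite expr_div_n cn => /divr1_eq.
have ewc : w = c by exact: cpow_root_unique.
(* At w = c each of the n terms is 1, so the sum is n, which is nonzero in characteristic 0. *)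
move: sum0; rewrite ewc mulfV //; under eq_bigr => i _ do rewrite expr1n.
by move/eqP; rewrite sumr_const card_ord pnatr_eq0 eqn0Ngt n_gt0.
Qed.

Lemma pseudo_zero_Q_stable (R : realType) (n : nat) (z w : R[i]) :
  (0 < n)%N -> 0 < complex.Re z ->
  pseudo_zero n%:R^-1 (Q_prod n 1 z) w -> stable_region n%:R^-1 w.
Proof.
move=> n_gt0 z_gt0; rewrite (funext (Q_prod1E n z)) pseudo_zeroE; last first.
  by rewrite invr_eq0 pnatr_eq0 -lt0n.
rewrite big_cons big_seq1 rootM => /orP[]; apply: root_geometric_stable => //.
(* The second factor belongs to [z^*], whose real part is that of z. *)
by case: z z_gt0.
Qed.

(** The same B serves as witness: with the convention that 0 is its own inverse, inversion is
    injective on all of [R[i]], so equal inverses give equal values at every s. *)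
Lemma pseudo_pole_Q_zero (R : realType) (n : nat) (alpha : R) (z w : R[i]) :
  pseudo_pole alpha (Q_prod n (-1) z) w -> pseudo_zero alpha (Q_prod n 1 z) w.
Proof.
move=> [B eB rootB]; exists B => // s.
by apply: invr_inj; rewrite -Q_prodN1E eB.
Qed.

Theorem mainTheorem1 (R : realType) (nu : nat) (hnu : (1 <= nu)%N)
    (alpha : R) (halpha : alpha = 1 / nu%:R)
    (omega0 phi : R) (z : R[i])
    (hz : z = cpolar omega0 phi) (homega0 : 0 < omega0)
    (hphi : phi = carg z) (hRe : 0 < complex.Re z)
    (k : int) (hk : k = -1 \/ k = 1) :
  (k = 1 -> forall w : R[i],
     pseudo_zero alpha (Q_prod nu k z) w -> stable_region alpha w) /\
  (k = -1 -> forall w : R[i],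
     pseudo_pole alpha (Q_prod nu k z) w -> stable_region alpha w).
Proof.
have -> : alpha = nu%:R^-1 by rewrite halpha div1r.
split=> -> w; first exact: pseudo_zero_Q_stable.
by move/pseudo_pole_Q_zero; apply: pseudo_zero_Q_stable.
Qed.
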